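(* Let $B$ be a translation invariant differentiation basis in $\mathbb{R}^2$. Then every $R_B$-set $E\subset\Gamma_2$ is a set of type $G_\delta$ in $\Gamma_2$.
   Context: A differentiation basis in $\mathbb{R}^n$ is a mapping $B$ assigning to each $x\in\mathbb{R}^n$ a family $B(x)$ of bounded measurable sets of positive Lebesgue measure containing $x$, such that there is a sequence $R_k\in B(x)$ with $\operatorname{diam}R_k\to 0$. $B$ is translation invariant if $B(x)=\{x+R: R\in B(0)\}$ for every $x$. For $f\in L(\mathbb{R}^n)$ the upper and lower derivatives of $\int f$ at $x$ with respect to $B$ are $\overline{D}_B(\int f,x)=\limsup_{R\in B(x),\,\operatorname{diam}R\to0}\frac{1}{|R|}\int_R f$ and $\underline{D}_B(\int f,x)=\liminf_{R\in B(x),\,\operatorname{diam}R\to0}\frac{1}{|R|}\int_R f$; $B$ differentiates $\int f$ if both equal $f(x)$ for almost every $x$. $F_B$ denotes the class of $f\in L(\mathbb{R}^n)$ whose integrals are differentiated by $B$. $\Gamma_2$ is the set of rotations of $\mathbb{R}^2$ about the origin, identified with the unit circle $\mathbb{T}$ (a rotation by angle $\theta$ corresponds to $e^{i\theta}$), with the distance between two rotations being the length of the shorter arc of $\mathbb{T}$ between the corresponding points; the topology on $\Gamma_2$ is that of this metric. For $\gamma\in\Gamma_2$ the $\gamma$-rotated basis is $B(\gamma)(x)=\{x+\gamma(R-x): R\in B(x)\}$. A set $E\subset\Gamma_2$ is an $R_B$-set if there exists $f\in L(\mathbb{R}^2)$ such that (1) for every $\gamma\in E$, $\overline{D}_{B(\gamma)}(\int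 f,x)=\infty$ for almost every $x\in\mathbb{R}^2$, and (2) $f\in F_{B(\gamma)}$ for every $\gamma\notin E$. *)

(* Defs.v *)
(* Differentiation bases in R^2 and R_B-sets. *)
From HB Require Import structures.
From mathcomp Require Import all_boot all_order all_algebra.
From mathcomp Require Import all_classical all_reals all_analysis.
Import Order.TTheory GRing.Theory Num.Theory.

Set Implicit Arguments.
Unset Strict Implicit.
Unset Printing Implicit Defensive.

Local Open Scope classical_set_scope.
Local Open Scope ring_scope.

Section Plane.
Variable R : realType.

(** Product (Borel) measure on R x R, then its completion (Caratheodory
    extension): this is the 2-dimensional Lebesgue measure, defined on the
    Lebesgue measurable subsets of R^2. *)
Definition leb_prod := ((@lebesgue_measure R) \x (@lebesgue_measure R))%E.

Definition plane : measurableType _ :=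
  caratheodory_type ((leb_prod : {measure set _ -> \bar R})^*)%mu.

Definition leb2 : {measure set plane -> \bar R} :=
  @completed_measure_extension _ _ _ (leb_prod : {measure set _ -> \bar R}).

(** Euclidean distance on the plane *)
Definition edist (p q : plane) : R :=
  Num.sqrt ((p.1 - q.1) ^+ 2 + (p.2 - q.2) ^+ 2).

Definition bounded2 (A : set plane) : Prop :=
  exists M : R, forall p q, A p -> A q -> edist p q <= M.

(** Euclidean diameter (in the extended reals) *)
Definition diam (A : set plane) : \bar R :=
  ereal_sup [set (edist pq.1 pq.2)%:E | pq in A `*` A].

Definition origin : plane := (0, 0).

Definition padd (p q : plane) : plane := (p.1 + q.1, p.2 + q.2).
Definition psub (p q : plane) : plane := (p.1 - q.1, p.2 - q.2).

(** x + R *)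
Definition shift (x : plane) (A : set plane) : set plane := padd x @` A.

(** A differentiation basis: B x is a family of bounded measurable sets of
    positive measure containing x, and there is a sequence R_k in B x with
    diam R_k -> 0. *)
Definition diff_basis (B : plane -> set (set plane)) : Prop :=
  forall x : plane,
    (forall A, B x A ->
       [/\ measurable A, bounded2 A, (0 < leb2 A)%E & A x]) /\
    (exists Rk : nat -> set plane, (forall k, B x (Rk k)) /\
       forall e : R, 0 < e -> exists N : nat,
         forall k, (N <= k)%N -> (diam (Rk k) < e%:E)%E).

Definition translation_invariant (B : plane -> set (set plane)) : Prop :=
  forall x : plane, B x = [set shift x A | A in B origin].

(** mean value of f over A *)
Definition avg (f : plane -> R) (A : set plane) : \bar R :=
  ((\int[leb2]_(y in A) (f y)%:E) * ((fine (leb2 A))^-1)%:E)%E.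

(** upper and lower derivatives of the integral of f at x w.r.t. B:
    limsup / liminf of avg f A as A ranges over B x with diam A -> 0 *)
Definition upper_der (B : plane -> set (set plane)) (f : plane -> R)
    (x : plane) : \bar R :=
  ereal_inf [set ereal_sup [set avg f A | A in [set A | B x A /\ (diam A < d%:E)%E]]
            | d in [set d : R | 0 < d]].

Definition lower_der (B : plane -> set (set plane)) (f : plane -> R)
    (x : plane) : \bar R :=
  ereal_sup [set ereal_inf [set avg f A | A in [set A | B x A /\ (diam A < d%:E)%E]]
            | d in [set d : R | 0 < d]].

(** B differentiates the integral of f *)
Definition differentiates (B : plane -> set (set plane)) (f : plane -> R) : Prop :=
  {ae leb2, forall x, upper_der B f x = (f x)%:E /\ lower_der B f x = (f x)%:E}.

(** Gamma_2: rotations of R^2, identified with unit vectors (cos t, sin t)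
    (i.e. points e^{it} of the unit circle). *)
Definition Gamma2 := {g : R * R | g.1 ^+ 2 + g.2 ^+ 2 = 1}.

(** action of the rotation g = (cos t, sin t) on a point of the plane *)
Definition rot (g : Gamma2) (p : plane) : plane :=
  ((sval g).1 * p.1 - (sval g).2 * p.2, (sval g).2 * p.1 + (sval g).1 * p.2).

(** length of the shorter arc of the unit circle between g and h *)
Definition arc_dist (g h : Gamma2) : R :=
  acos ((sval g).1 * (sval h).1 + (sval g).2 * (sval h).2).

Definition Gamma2_open (U : set Gamma2) : Prop :=
  forall g, U g -> exists2 e : R, 0 < e & forall h, arc_dist g h < e -> U h.

Definition Gdelta (E : set Gamma2) : Prop :=
  exists U : nat -> set Gamma2,
    (forall n, Gamma2_open (U n)) /\ E = \bigcap_n U n.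

(** the gamma-rotated basis: B(gamma)(x) = { x + gamma (R - x) : R in B x } *)
Definition rotated_basis (B : plane -> set (set plane)) (g : Gamma2)
    : plane -> set (set plane) :=
  fun x => [set (fun r => padd x (rot g (psub r x))) @` A | A in B x].

(** E is an R_B-set *)
Definition RB_set (B : plane -> set (set plane)) (E : set Gamma2) : Prop :=
  exists f : plane -> R,
    leb2.-integrable setT (EFin \o f) /\
    (forall g, E g -> {ae leb2, forall x, upper_der (rotated_basis B g) f x = +oo%E}) /\
    (forall g, ~ E g -> differentiates (rotated_basis B g) f).

End Plane.

(* Main.v *)
(* Let W_m(g) be the set of x for which some R in B(g)(x) has diameter less than
   1/(m+1) and mean value greater than m. Then the upper derivative at x is
   +oo iff x belongs to every W_m(g). Translation invariance writes R as
   x + g(A) with A in B(0), and the integral of f over x + g(A) is jointly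
   continuous in (x, g) (rotation invariance and regularity of the Lebesgue
   measure, absolute continuity of the integral), so {(x, g) | x in W_m(g)} is
   open and g |-> |Q n W_m(g)| is lower semicontinuous for a fixed square Q.
   If g is in E this measure is |Q| for all m; otherwise it tends to 0. Hence E
   is the intersection over m of the open sets {g | |Q n W_m(g)| > 1}. *)
Require Import Defs.
From HB Require Import structures.
From mathcomp Require Import all_boot all_order all_algebra.
From mathcomp Require Import all_classical all_reals all_analysis.
From mathcomp Require Import measurable_realfun ring lra.
Import Order.TTheory GRing.Theory Num.Theory.
Import numFieldNormedType.Exports.

Set Implicit Arguments.
Unset Strict Implicit.
Unset Printing Implicit Defensive.

Local Open Scope classical_set_scope.
Local Open Scope ring_scope.

(** * Measure-preserving maps of the plane *)

(** The points of [plane R] with the product Borel sigma-algebra; [plane R] carries the larger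
    Lebesgue one. A set may be read in either type. *)
Notation borel2 R := (measurableTypeR R * measurableTypeR R)%type.

Section measure_preserving.
Variable R : realType.
Implicit Types (T : borel2 R -> borel2 R).

(** The pushforward under the translation gives each half-open interval its length, which
    characterizes Lebesgue measure. *)
Lemma lebesgue_measure_translation (a : R) (A : set (measurableTypeR R)) :
  measurable A ->
  lebesgue_measure ((fun x : R => x + a) @^-1` A) = lebesgue_measure A.
Proof.
move=> mA.
have mt : measurable_fun setT
    (fun x : measurableTypeR R => (x + a : measurableTypeR R)).
  by apply: measurable_funD => //; exact: measurable_cst.
apply/esym.
apply: (lebesgue_measure_unique
  (mu := pushforward (@lebesgue_measure R)
    (fun x : measurableTypeR R => (x + a : measurableTypeR R)))) => //.
move=> _ [[c d] _ <-]; rewrite /= /pushforward.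
rewrite (_ : _ @^-1` _ = `]c - a, d - a]%classic); last first.
  by apply/seteqP; split => x /=; rewrite !in_itv/= => /andP[? ?];
    apply/andP; split; lra.
rewrite !lebesgue_measure_itv/= !lte_fin ltrD2r.
case: ifP => // _; rewrite -!EFinB; congr EFin; ring.
Qed.

Definition preserves_leb T := measurable_fun setT T /\
  forall A, measurable A -> leb_prod (T @^-1` A) = leb_prod A.

Lemma preserves_leb_comp T1 T2 :
  preserves_leb T1 -> preserves_leb T2 -> preserves_leb (T1 \o T2).
Proof.
move=> [m1 p1] [m2 p2]; split; first exact: measurableT_comp.
move=> A mA; rewrite comp_preimage p2 ?p1//.
by rewrite -[X in measurable X]setTI; exact: m1.
Qed.

(** The product measure integrates the measures of vertical sections, and the shear only translates
    each of them. *)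
Lemma preserves_leb_vshear (g : R -> R) : measurable_fun setT g ->
  preserves_leb (fun p => (p.1, p.2 + g p.1)).
Proof.
move=> mg; set T := (fun p => _).
have mT : measurable_fun setT T.
  apply: measurable_fun_pair; first exact: measurable_fst.
  apply: measurable_funD; first exact: measurable_snd.
  apply: measurableT_comp => //; exact: measurable_fst.
split=> // A mA; apply: eq_integral => x _ /=.
rewrite -[RHS](lebesgue_measure_translation (g x)); last first.
  exact: measurable_xsection.
by congr lebesgue_measure; rewrite !xsectionE.
Qed.

(** Here horizontal sections are translated, so the product measure is first rewritten, by
    uniqueness, as integration in the other order. *)
Lemma preserves_leb_hshear (g : R -> R) : measurable_fun setT g ->
  preserves_leb (fun p => (p.1 + g p.2, p.2)).
Proof.
move=> mg; set T := (fun p => _).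
have mT : measurable_fun setT T.
  apply: measurable_fun_pair; last exact: measurable_snd.
  apply: measurable_funD; first exact: measurable_fst.
  apply: measurableT_comp => //; exact: measurable_snd.
have E A : measurable A -> leb_prod A =
    ((@lebesgue_measure R) \x^ (@lebesgue_measure R))%E A.
  move=> mA; apply: product_measure_unique => // ? ? ? ? /=.
  by rewrite product_measure2E.
split=> // A mA; rewrite !E//; last first.
  by rewrite -[X in measurable X]setTI; exact: mT.
apply: eq_integral => y _ /=.
rewrite -[RHS](lebesgue_measure_translation (g y)); last first.
  exact: measurable_ysection.
by congr lebesgue_measure; rewrite !ysectionE.
Qed.

Definition motion (a b c s : R) (p : borel2 R) : borel2 R :=
  (a + (c * p.1 - s * p.2), b + (s * p.1 + c * p.2)).

(* A rotation other than the half turn is a product of three shears, with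
   parameters -tan(t/2), sin t, -tan(t/2); the half turn is the square of a
   quarter turn. *)
Lemma preserves_leb_motion a b c s : c ^+ 2 + s ^+ 2 = 1 ->
  preserves_leb (motion a b c s).
Proof.
wlog cN1 : a b c s / c != -1 => [hwlog|] cs.
  have [cN1|] := eqVneq c (-1); last by move=> ?; exact: hwlog.
  have s0 : s = 0 by apply/eqP; rewrite -sqrf_eq0; apply/eqP; nra.
  have -> : motion a b c s = motion a b 0 1 \o motion 0 0 0 1.
    by apply/funext => -[x y]; rewrite /motion /= cN1 s0; congr pair; ring.
  have q a' b' : preserves_leb (motion a' b' 0 1).
    apply: hwlog; last by ring.
    by rewrite eq_sym oppr_eq0 oner_eq0.
  exact: preserves_leb_comp.
have c1 : 1 + c != 0 by rewrite addrC; move: cN1; rewrite -subr_eq0 opprK.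
pose t := s / (1 + c).
have st : t * s = 1 - c.
  rewrite /t; apply: (mulfI c1); rewrite [LHS](_ : _ = s ^+ 2); last by field.
  by rewrite (_ : s ^+ 2 = 1 - c ^+ 2); [ring | lra].
have tc : t * c = s - t by rewrite /t; field.
have mX (k : R) : measurable_fun setT (fun x : measurableTypeR R => k * x).
  by apply: measurable_funM => //; exact: measurable_cst.
have mD (k l : R) :
    measurable_fun setT (fun x : measurableTypeR R => k * x + l).
  by apply: measurable_funD => //; exact: measurable_cst.
(* The last two shears also carry the translation; [t * b] cancels what the last shear makes of the
   offset [b]. *)
have -> : motion a b c s =
    (fun p => (p.1 + (- t * p.2 + (a + t * b)), p.2)) \o
    ((fun p => (p.1, p.2 + (s * p.1 + b))) \o
     (fun p => (p.1 + - t * p.2, p.2))).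
  apply/funext => -[x y]; rewrite /motion /=; congr pair.
    transitivity (a + (x * (1 - t * s) - y * (t + t * (1 - t * s)))).
      rewrite st; rewrite (_ : t + _ = t + t * c); last by ring.
      by rewrite tc; ring.
    by ring.
  transitivity (b + (s * x + y * (1 - t * s))); last by ring.
  by rewrite st; ring.
apply: preserves_leb_comp.
  exact: (preserves_leb_hshear (mD (- t) (a + t * b))).
apply: preserves_leb_comp.
  exact: (preserves_leb_vshear (mD s b)).
exact: (preserves_leb_hshear (mX (- t))).
Qed.

(** [leb2] is an infimum over countable Borel covers, and the preimages of a cover of [A] cover the
    preimage of [A] with the same total measure. *)
Lemma leb2_preimage_le T (A : set (plane R)) : preserves_leb T ->
  (leb2 R (T @^-1` A : set (plane R)) <= leb2 R A)%E.
Proof.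
move=> [mT pT]; rewrite /leb2 /= /completed_measure_extension /mu_ext.
apply: le_ereal_inf_tmp => _ [F [mF AF] <-].
have mTF k : measurable (T @^-1` F k).
  by rewrite -[X in measurable X]setTI; exact: mT.
apply: ereal_inf_lbound; exists (fun k => T @^-1` F k).
  by split => // x /AF[k _ Fk]; exists k.
by apply: eq_eseriesr => k _ /=; exact: pT.
Qed.

Lemma leb2_preimage T T' (A : set (plane R)) :
  preserves_leb T -> preserves_leb T' -> cancel T' T ->
  leb2 R (T @^-1` A : set (plane R)) = leb2 R A.
Proof.
move=> pT pT' T'K.
apply/eqP; rewrite eq_le leb2_preimage_le//=.
have {1}-> : A = T' @^-1` (T @^-1` A).
  by apply/seteqP; split => x /=; rewrite T'K.
exact: leb2_preimage_le.
Qed.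

(** Measurability in [plane R] is defined by this Caratheodory condition, so both directions hold by
    conversion. *)
Lemma measurable_planeP (A : set (plane R)) : measurable A <->
  forall X : set (plane R),
    leb2 R X = (leb2 R (X `&` A) + leb2 R (X `&` ~` A))%E.
Proof. by split. Qed.

(** Taking preimages under [T'] turns a test set for the preimage of [A] into one for [A] and keeps
    all three measures. *)
Lemma measurable_preimage_iso T T' (A : set (plane R)) :
  preserves_leb T -> preserves_leb T' -> cancel T T' -> cancel T' T ->
  measurable A -> measurable (T @^-1` A : set (plane R)).
Proof.
move=> pT pT' TK T'K /measurable_planeP mA; apply/measurable_planeP => X.
have L := leb2_preimage _ pT' pT TK.
rewrite -[LHS]L mA; congr (_ + _)%E; rewrite -[RHS]L; congr (leb2 R _).
  by apply/seteqP; split => x /=; rewrite T'K.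
by apply/seteqP; split => x /=; rewrite T'K.
Qed.

End measure_preserving.

(** * Regularity of finite Borel measures on the plane *)

Section measure_limits.
Context d (T : measurableType d) (R : realType).
Variable mu : {measure set T -> \bar R}.

Lemma measure_bigcap_lt (F : (set T)^nat) (e : \bar R) :
  (mu (F 0%N) < +oo)%E -> (forall n, measurable (F n)) ->
  {homo F : n m / (n <= m)%N >-> (m <= n)%O} ->
  (mu (\bigcap_n F n) < e)%E -> exists n, (mu (F n) < e)%E.
Proof.
move=> F0 mF dF lte.
have /(_ _ (open_ereal_lt' lte))[N _ /(_ N)/=]:= nonincreasing_cvg_mu F0 mF
  (bigcapT_measurable mF) dF.
by move=> h; exists N; exact: h.
Qed.

Lemma measure_bigcup_gt (F : (set T)^nat) (e : \bar R) :
  (forall n, measurable (F n)) ->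
  {homo F : n m / (n <= m)%N >-> (n <= m)%O} ->
  (e < mu (\bigcup_n F n))%E -> exists n, (e < mu (F n))%E.
Proof.
move=> mF iF lte.
have /(_ _ (open_ereal_gt' lte))[N _ /(_ N)/=]:= nondecreasing_cvg_mu
  (mu := mu) mF (bigcupT_measurable F mF) iF.
by move=> h; exists N; exact: h.
Qed.

End measure_limits.

(** * Neighbourhoods of closed sets; open sets are Borel *)

Section plane_topology.
Variable R : realType.

(** Balls of [R * R] are those of the maximum distance, that is, open squares. *)
Definition nbhd (K : set (R * R)) (e : R) : set (R * R) :=
  \bigcup_(q in K) ball q e.

Lemma open_nbhd K e : open (nbhd K e).
Proof. by apply: bigcup_open => q _; exact: (@ball_open R (R * R)%type). Qed.

Lemma sub_nbhd K e : 0 < e -> K `<=` nbhd K e.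
Proof. by move=> e0 x Kx; exists x => //; exact: ballxx. Qed.

Lemma nbhd_le K e e' : e <= e' -> nbhd K e `<=` nbhd K e'.
Proof. by move=> ee' x [q Kq qx]; exists q => //; exact: le_ball qx. Qed.

Lemma inv_nat_lt (e : R) : 0 < e -> exists n, n.+1%:R^-1 < e.
Proof.
by move=> e0; have [n] := ltr_add_invr e0; rewrite add0r => ?; exists n.
Qed.

Lemma inv_nat_le (n m : nat) : (n <= m)%N -> m.+1%:R^-1 <= n.+1%:R^-1 :> R.
Proof. by move=> nm; rewrite lef_pV2 ?posrE ?ler_nat. Qed.

Lemma closed_bigcap_nbhd K : closed K ->
  \bigcap_n nbhd K n.+1%:R^-1 = K.
Proof.
move=> cK; apply/seteqP; split => [x xK|x Kx n _]; last exact: sub_nbhd.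
apply: contrapT => nKx.
have /nbhs_ballP[e /= e0 eK] : nbhs x (~` K).
  by apply: open_nbhs_nbhs; split => //; exact: closed_openC.
have [n ne] := inv_nat_lt e0.
have [q Kq qx] := xK n Logic.I.
by apply: (eK q) => //; apply: le_ball (ball_sym qx); exact: ltW.
Qed.

(** An open set is the countable union of the boxes inside it that have rational centre and radius
    1/(n+1). *)
Lemma open_measurable2 (U : set (R * R)) : open U ->
  measurable (U : set (borel2 R)).
Proof.
move=> oU.
pose box (i : rat * rat * nat) : set (R * R) :=
  ball (ratr i.1.1 : R) i.2.+1%:R^-1 `*` ball (ratr i.1.2 : R) i.2.+1%:R^-1.
pose F i : set (borel2 R) := if `[< box i `<=` U >] then box i else set0.
have -> : U = \bigcup_i F i.
  apply/seteqP; split => [x Ux|x [i _]]; last first.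
    by rewrite /F; case: asboolP => // + bx; apply.
  have /nbhs_ballP[e /= e0 eU] : nbhs x U by exact: open_nbhs_nbhs.
  (* Half of [e], because a box whose centre is within 1/(n+1) of [x] stays within 2/(n+1) of
     [x]. *)
  have [n ne] : exists n, n.+1%:R^-1 < e / 2.
    by apply: inv_nat_lt; rewrite divr_gt0.
  have n0 : 0 < n.+1%:R^-1 :> R by rewrite invr_gt0.
  have rat_near (y : R) : exists q : rat, `|ratr q - y| < n.+1%:R^-1.
    have [q] : exists q : rat, ratr q \in `]y - n.+1%:R^-1, y + n.+1%:R^-1[.
      by apply: rat_in_itvoo; rewrite ltrBlDr -addrA ltrDl addr_gt0.
    rewrite in_itv /= => /andP[? ?]; exists q.
    by rewrite ltr_distl; apply/andP; split.
  have [q1 hq1] := rat_near x.1; have [q2 hq2] := rat_near x.2.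
  exists ((q1, q2), n) => //; rewrite /F; case: asboolP => [_|].
    by split.
  case=> y [/= b1 b2]; apply: eU; split => /=.
    apply: (@le_ball _ _ _ (n.+1%:R^-1 + n.+1%:R^-1)).
      by rewrite [leRHS]splitr lerD// ltW.
    by apply: ball_triangle b1; rewrite -ball_normE /ball_ /= distrC.
  apply: (@le_ball _ _ _ (n.+1%:R^-1 + n.+1%:R^-1)).
      by rewrite [leRHS]splitr lerD// ltW.
  by apply: ball_triangle b2; rewrite -ball_normE /ball_ /= distrC.
apply: countable_bigcupT_measurable; first exact: countableP.
move=> i; rewrite /F; case: asboolP => // _.
by apply: measurableX; apply: open_measurable; exact: (@ball_open R R).
Qed.

Lemma closed_measurable2 (K : set (R * R)) : closed K ->
  measurable (K : set (borel2 R)).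
Proof.
move=> cK; rewrite -[K]setCK; apply: measurableC.
by apply: open_measurable2; exact: closed_openC.
Qed.

End plane_topology.

Section regularity.
Variables (R : realType) (nu : {measure set (borel2 R) -> \bar R}).
Hypothesis nufin : (nu setT < +oo)%E.

(** Approximating from both sides makes the notion stable under complement. *)
Definition regular (A : set (borel2 R)) := forall e : R, 0 < e ->
  exists C U : set (R * R), [/\ closed C, open U, C `<=` A, A `<=` U &
    (nu (U `\` C) < e%:E)%E].

Let nu_lty (A : set (borel2 R)) : measurable A -> (nu A < +oo)%E.
Proof.
by move=> mA; apply: le_lt_trans nufin; apply: le_measure; rewrite ?inE.
Qed.

(** [K] is its own inner approximation; its neighbourhoods decrease to [K], so finiteness of [nu]
    gives the outer one by continuity from above. *)
Lemma closed_regular (K : set (R * R)) : closed K -> regular K.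
Proof.
move=> cK e e0.
have mN n : measurable (nbhd K n.+1%:R^-1 : set (borel2 R)).
  by apply: open_measurable2; exact: open_nbhd.
have mK := closed_measurable2 cK.
have := @measure_bigcap_lt _ _ _ nu (fun n => nbhd K n.+1%:R^-1 `\` K) e%:E.
case.
- by apply: nu_lty; exact: measurableD.
- by move=> n; exact: measurableD.
- move=> n m nm; apply/subsetPset; apply: setSD; apply: nbhd_le.
  exact: inv_nat_le.
- rewrite (_ : \bigcap_n _ = set0) ?measure0 ?lte_fin//.
  apply/seteqP; split => // x Fx.
  have : (\bigcap_n nbhd K n.+1%:R^-1) x by move=> n _; have [] := Fx n Logic.I.
  by rewrite closed_bigcap_nbhd//; have [] := Fx 0%N Logic.I.
move=> n ne; exists K, (nbhd K n.+1%:R^-1); split => //.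
- exact: open_nbhd.
- exact: sub_nbhd.
Qed.

Lemma regularC A : regular A -> regular (~` A).
Proof.
move=> rA e /rA[C [U [cC oU CA AU UC]]]; exists (~` U), (~` C); split.
- exact: open_closedC.
- exact: closed_openC.
- exact: subsetC.
- exact: subsetC.
- by rewrite setDE setCK setIC -setDE.
Qed.

Lemma regular_bigcup (A : (set (borel2 R))^nat) :
  (forall n, regular (A n)) -> regular (\bigcup_n A n).
Proof.
move=> rA e e0; have e2 : 0 < e / 2 by rewrite divr_gt0.
have /choice[CU hCU] n : exists CU : set (R * R) * set (R * R),
    [/\ closed CU.1, open CU.2, CU.1 `<=` A n, A n `<=` CU.2 &
    (nu (CU.2 `\` CU.1) < (e / 2 / (2 ^ n.+1)%:R)%:E)%E].
  have [|C [U ?]] := rA n (e / 2 / (2 ^ n.+1)%:R); last by exists (C, U).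
  by rewrite divr_gt0// ltr0n expn_gt0.
pose C n := (CU n).1; pose U n := (CU n).2.
have mC n : measurable (C n : set (borel2 R)).
  by apply: closed_measurable2; have [] := hCU n.
have oU : open (\bigcup_n U n) by apply: bigcup_open => n _; have [] := hCU n.
have mU n : measurable (U n : set (borel2 R)).
  by apply: open_measurable2; have [] := hCU n.
have mUU := open_measurable2 oU.
(* The union of all [C k] need not be closed, so only the first n are kept; [V n] decreases to a set
   of measure at most e/2. *)
pose V n : set (borel2 R) := \bigcup_n U n `\` \big[setU/set0]_(k < n) C k.
have [||||n hn] := @measure_bigcap_lt _ _ _ nu V e%:E.
- by apply: nu_lty; apply: measurableD => //; exact: bigsetU_measurable.
- by move=> n; apply: measurableD => //; exact: bigsetU_measurable.
- by move=> n m nm; apply/subsetPset; apply: setDS; exact: subset_bigsetU.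
- apply: (@le_lt_trans _ _ (e / 2)%:E); last by rewrite lte_fin; lra.
  apply: (le_trans _ (epsilon_trick0 xpredT (ltW e2))).
  apply: (@le_trans _ _ (\sum_(n <oo) nu (U n `\` C n))%E); last first.
    apply: lee_nneseries => // n _; apply: ltW; by have [] := hCU n.
  apply: measure_sigma_subadditive.
  + by move=> n; exact: measurableD.
  + apply: bigcapT_measurable => n; apply: measurableD => //.
    exact: bigsetU_measurable.
  + move=> x Vx; have [[n _ Unx] _] := Vx 0%N Logic.I.
    (* [C n] is removed only from [V n.+1] on, since the finite union runs over k < n. *)
    exists n => //; split => // Cnx; have [_] := Vx n.+1 Logic.I; apply.
    by rewrite big_ord_recr/=; right.
exists (\big[setU/set0]_(k < n) C k), (\bigcup_n U n); split => //.
- by apply: closed_bigsetU => k _; have [] := hCU k.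
- move=> x; rewrite -bigcup_mkord => -[k _ Ckx]; exists k => //.
  by have [_ _ + _ _] := hCU k; apply.
- move=> x [k _ Akx]; exists k => //.
  by have [_ _ _ + _] := hCU k; apply.
Qed.

Lemma sigma_algebra_regular : sigma_algebra setT regular.
Proof.
split.
- exact: (closed_regular closed0).
- by move=> A rA; rewrite setTD; exact: regularC.
- exact: regular_bigcup.
Qed.

Lemma open_regular (U : set (R * R)) : open U -> regular U.
Proof.
move=> oU; rewrite -[U]setCK; apply: regularC; apply: closed_regular.
exact: open_closedC.
Qed.

(** Rectangles generate the Borel sets, and a rectangle is an intersection of preimages under the
    two projections. By continuity these preimages are regular for open intervals, hence for all
    Borel sets of the line. *)
Lemma measurable_regular (A : set (borel2 R)) : measurable A -> regular A.
Proof.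
have [r0 _ rU] := sigma_algebra_regular.
have reg_preim (h : R * R -> R) : (forall x, {for x, continuous h}) ->
    forall B : set (measurableTypeR R), measurable B -> regular (h @^-1` B).
  move=> ch B mB; have {mB} : (@RGenOpens.G R).-sigma.-measurable B.
    by rewrite -RGenOpens.measurableE.
  move: B; apply: (@smallest_sub _ _ _ [set B | regular (h @^-1` B)]).
    split => /=.
    - by rewrite preimage_set0.
    - by move=> D rD; rewrite setTD preimage_setC; exact: regularC.
    - by move=> D rD; rewrite preimage_bigcup; exact: rU.
  move=> _ [x [y ->]] /=; apply: open_regular; apply: open_comp.
    by move=> z _; exact: ch.
  exact: interval_open.
have regI (B D : set (borel2 R)) : regular B -> regular D -> regular (B `&` D).
  move=> rB rD; rewrite -[_ `&` _]setCK setCI -bigcup2E; apply: regularC.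
  by apply: rU => -[|[|n]] //=; exact: regularC.
rewrite measurable_prod_measurableType.
apply: smallest_sub; first exact: sigma_algebra_regular.
move=> _ [B mB [D mD <-]].
rewrite (_ : B `*` D = (fst @^-1` B) `&` (snd @^-1` D)) //.
have cfst (x : R * R) : {for x, continuous (fst : R * R -> R)}.
  exact: cvg_fst.
have csnd (x : R * R) : {for x, continuous (snd : R * R -> R)}.
  exact: cvg_snd.
exact: (regI _ _ (reg_preim _ cfst _ mB) (reg_preim _ csnd _ mD)).
Qed.

End regularity.

(** * Continuity of averages under rigid motions *)

Section finite_measure_sets.
Context d (T : measurableType d) (R : realType).
Variable mu : {measure set T -> \bar R}.

Lemma measure_setD_lt (A B C : set T) (e : R) :
  measurable A -> measurable B -> measurable C ->
  (mu (A `\` B) < (e / 2)%:E)%E -> (mu (B `\` C) < (e / 2)%:E)%E ->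
  (mu (A `\` C) < e%:E)%E.
Proof.
move=> mA mB mC AB BC.
apply: (@le_lt_trans _ _ (mu (A `\` B `|` B `\` C))); last first.
  apply: (le_lt_trans (measureU2 _ _ _)); try exact: measurableD.
  by rewrite [e in ltRHS]splitr EFinD; exact: lteD.
apply: le_measure; rewrite ?inE; first exact: measurableD.
  by apply: measurableU; exact: measurableD.
move=> x [Ax nCx]; have [Bx|nBx] := pselect (B x); first by right.
by left.
Qed.

(** Both sides are the common measure minus that of the intersection. *)
Lemma measure_setD_sym (A B : set T) : measurable A -> measurable B ->
  (mu A < +oo)%E -> mu A = mu B -> mu (A `\` B) = mu (B `\` A).
Proof.
move=> mA mB Afin AB; have Bfin : (mu B < +oo)%E by rewrite -AB.
rewrite (measureD mA mB Afin) (measureD mB mA Bfin).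
by rewrite (setIC B A); congr (_ - _)%E.
Qed.

(** The part over the intersection cancels; absolute continuity of the integral bounds those over
    the two differences. *)
Lemma Rintegral_continuous (f : T -> R) (e : R) :
  mu.-integrable setT (EFin \o f) -> 0 < e ->
  exists2 r : R, 0 < r & forall A B, measurable A -> measurable B ->
    (mu (A `\` B) < r%:E)%E -> (mu (B `\` A) < r%:E)%E ->
    `|\int[mu]_(x in A) f x - \int[mu]_(x in B) f x| < e.
Proof.
move=> intf e0; have e2 : 0 < e / 2 by rewrite divr_gt0.
have [r [r0 hr]] := integral_normr_continuous intf e2.
have intS C : measurable C -> mu.-integrable C (EFin \o f).
  by move=> mC; exact: integrableS intf.
have smallD C : measurable C -> (mu C < r%:E)%E ->
    `|\int[mu]_(x in C) f x| < e / 2.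
  move=> mC /(hr _ mC); apply: le_lt_trans; apply: le_normr_Rintegral => //.
  exact: intS.
have split_int C D : measurable C -> measurable D ->
    \int[mu]_(x in C) f x =
    \int[mu]_(x in C `&` D) f x + \int[mu]_(x in C `\` D) f x.
  move=> mC mD; rewrite -Rintegral_setU ?setUIDK//.
  - exact: measurableI.
  - exact: measurableD.
  - exact: intS.
  - by apply/disj_setPS => x [[_ Dx] [_]].
exists r => // A B mA mB AB BA.
rewrite (split_int A B)// (split_int B A)// (setIC B A).
rewrite opprD addrACA subrr add0r.
apply: (le_lt_trans (ler_normB _ _)); rewrite [ltRHS]splitr.
by apply: ltrD; apply: smallD => //; exact: measurableD.
Qed.

End finite_measure_sets.

(** * Regularity of Lebesgue measure on bounded sets *)

Section plane_regularity.
Variable R : realType.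

Lemma measurable_plane (A : set (borel2 R)) : measurable A ->
  measurable (A : set (plane R)).
Proof. by move=> mA; exact: caratheodory_measurable_mu_ext. Qed.

Lemma leb2_borel (A : set (borel2 R)) : measurable A ->
  leb2 R A = leb_prod A.
Proof. by move=> mA; exact: measurable_mu_extE. Qed.

Definition box (M : R) : set (R * R) := `[- M, M]%classic `*` `[- M, M]%classic.

Lemma measurable_box M : measurable (box M : set (borel2 R)).
Proof. by apply: measurableX. Qed.

Lemma leb_box_lty M : (leb_prod (box M : set (borel2 R)) < +oo)%E.
Proof.
rewrite /leb_prod product_measure1E//= lebesgue_measure_itv/=.
by case: ifP; rewrite -?EFinB -?EFinM ?mul0e ltry.
Qed.

Lemma leb2_lty (A : set (plane R)) M : A `<=` box M -> (leb2 R A < +oo)%E.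
Proof.
move=> AM; apply: le_lt_trans (leb_box_lty M).
rewrite -(leb2_borel (measurable_box M)).
exact: le_outer_measure.
Qed.

(** A Borel set [X] covering the complement [D] of [A] in the box, with almost the outer measure of
    [D], is removed from the box. What is lost of [A] lies in [X] minus [D]. *)
Lemma leb2_borel_approx (A : set (plane R)) M (e : R) :
  measurable A -> A `<=` box M -> 0 < e ->
  exists Y : set (borel2 R),
    [/\ measurable Y, Y `<=` A & (leb2 R (A `\` Y) < e%:E)%E].
Proof.
move=> mA AM e0.
have mB := measurable_box M; have mBp := measurable_plane mB.
pose D : set (plane R) := box M `\` A.
have mD : measurable D by exact: measurableD.
have Dfin : leb2 R D \is a fin_num.
  by rewrite ge0_fin_numE//; apply: (@leb2_lty _ M) => x [].
have [_ [F [mF DF] <-] Fe] := lb_ereal_inf_adherent e0 Dfin.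
pose X : set (borel2 R) := \bigcup_k F k.
have mX : measurable X by exact: bigcupT_measurable.
have mXp := measurable_plane mX.
have Xe : (leb2 R X < leb2 R D + e%:E)%E.
  rewrite (leb2_borel mX); apply: le_lt_trans Fe.
  exact: measure_sigma_subadditive.
exists (box M `\` X); split; first exact: measurableD.
  move=> x [Bx nXx]; apply: contrapT => nAx; apply: nXx; apply: DF.
  by split.
apply: (@le_lt_trans _ _ (leb2 R (X `\` D))).
  apply: le_outer_measure => x [Ax nYx]; split; last by case.
  by apply: contrapT => nXx; apply: nYx; split => //; exact: AM.
rewrite measureD//; last first.
  by apply: lt_trans Xe _; rewrite lte_add_pinfty ?ltry// -ge0_fin_numE.
rewrite (_ : X `&` D = D) ?lteBlDr//; last exact/setIidr.
by rewrite addeC.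
Qed.

Lemma leb2_inner_regular (A : set (plane R)) M (e : R) :
  measurable A -> A `<=` box M -> 0 < e ->
  exists K : set (R * R),
    [/\ closed K, K `<=` A & (leb2 R (A `\` K) < e%:E)%E].
Proof.
move=> mA AM e0; have e2 : 0 < e / 2 by rewrite divr_gt0.
have [Y [mY YA Ae]] := leb2_borel_approx mA AM e2.
(* Regularity was shown for finite measures, hence the restriction to the box. *)
pose nu : {measure set (borel2 R) -> \bar R} :=
  mrestr (leb_prod (R := R)) (measurable_box M).
have nufin : (nu setT < +oo)%E by rewrite /nu/= /mrestr setTI leb_box_lty.
have [K [U [cK oU KY YU UK]]] := measurable_regular nufin mY e2.
have mK := closed_measurable2 cK; have mU := open_measurable2 oU.
exists K; split => //; first exact: subset_trans YA.
apply: (@measure_setD_lt _ _ _ (leb2 R) A Y K e) => //;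
  try exact: measurable_plane.
rewrite leb2_borel; last exact: measurableD.
apply: le_lt_trans UK; rewrite /nu/= /mrestr.
apply: le_measure; rewrite ?inE; try exact: measurableD.
  by apply: measurableI => //; [exact: measurableD|exact: measurable_box].
by move=> x [Yx nKx]; split; [split => //; exact: YU|apply: AM; exact: YA].
Qed.

Lemma leb2_nbhd_lt (K : set (R * R)) M (e : R) :
  closed K -> K `<=` box M -> 0 < e ->
  exists2 r : R, 0 < r & (leb2 R (nbhd K r `\` K) < e%:E)%E.
Proof.
move=> cK KM e0; have mK := closed_measurable2 cK.
have mN r : measurable (nbhd K r : set (borel2 R)).
  by apply: open_measurable2; exact: open_nbhd.
have [||||n hn] := @measure_bigcap_lt _ _ _ (leb2 R)
    (fun n => nbhd K n.+1%:R^-1 `\` K) e%:E.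
(* Continuity from above asks for a first set of finite measure; at n = 0 the radius is 1. *)
- apply: (@leb2_lty _ (M + 1)) => x [[q /KM [/=]]].
  rewrite !in_itv/= => /andP[? ?] /andP[? ?] [].
  rewrite -!ball_normE /ball_ /= invr1 !ltr_distl => /andP[? ?] /andP[? ?] _.
  by split; rewrite /= in_itv/=; apply/andP; split; lra.
- by move=> n; apply: measurable_plane; exact: measurableD.
- move=> n m nm; apply/subsetPset; apply: setSD; apply: nbhd_le.
  exact: inv_nat_le.
- rewrite (_ : \bigcap_n _ = set0) ?measure0 ?lte_fin//.
  apply/seteqP; split => // x Fx.
  have : (\bigcap_n nbhd K n.+1%:R^-1) x by move=> n _; have [] := Fx n Logic.I.
  by rewrite closed_bigcap_nbhd//; have [] := Fx 0%N Logic.I.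
by exists n.+1%:R^-1.
Qed.

End plane_regularity.

(** * Continuity of the average over a moving set *)

Section rigid_motions.
Variable R : realType.
Implicit Types (T : borel2 R -> borel2 R) (A : set (plane R)).

(** A bijection preserving the measure both ways; distances are treated separately, for
    [rmotion]. *)
Definition rigid T := exists T',
  [/\ preserves_leb T, preserves_leb T', cancel T T' & cancel T' T].

Lemma image_cancel (X Y : Type) (f : X -> Y) (g : Y -> X) (A : set X) :
  cancel f g -> cancel g f -> f @` A = g @^-1` A.
Proof.
move=> fK gK; apply/seteqP; split => y /=; first by case=> x Ax <-; rewrite fK.
by move=> Agy; exists (g y) => //; rewrite gK.
Qed.

Lemma measurable_rigid T A : rigid T -> measurable A ->
  measurable (T @` A : set (plane R)).
Proof.
move=> [T' [pT pT' TK T'K]] mA; rewrite (image_cancel _ TK T'K).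
exact: (measurable_preimage_iso pT' pT T'K TK mA).
Qed.

Lemma leb2_rigid T A : rigid T -> leb2 R (T @` A) = leb2 R A.
Proof.
move=> [T' [pT pT' TK T'K]]; rewrite (image_cancel _ TK T'K).
exact: (leb2_preimage _ pT' pT TK).
Qed.

(** A closed [K] fills most of the image under [T], and its r-neighbourhood is hardly larger.
    Following [T^-1] by [T'] moves [K] to a set [K'] of equal measure inside that neighbourhood and
    inside the image under [T'], so [K'] covers most of [K]. *)
Lemma leb2_rigid_continuous T A M (e : R) : rigid T -> measurable A ->
  T @` A `<=` box M -> 0 < e ->
  exists2 r : R, 0 < r & forall T', rigid T' ->
    (forall p, A p -> ball (T p : R * R) r (T' p)) ->
    (leb2 R (T @` A `\` T' @` A) < e%:E)%E /\
    (leb2 R (T' @` A `\` T @` A) < e%:E)%E.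
Proof.
move=> rT mA TAM e0; have e2 : 0 < e / 2 by rewrite divr_gt0.
have mTA := measurable_rigid rT mA.
have [K [cK KTA Ke]] := leb2_inner_regular mTA TAM e2.
have KM := subset_trans KTA TAM.
have [r r0 re] := leb2_nbhd_lt cK KM e2.
exists r => // T' rT' TT'.
have mT'A := measurable_rigid rT' mA.
have mK : measurable (K : set (plane R)).
  by apply: measurable_plane; exact: closed_measurable2.
have [S [pT pS TK SK]] := rT.
have mSK : measurable (S @` K : set (plane R)).
  by apply: measurable_rigid => //; exists T.
have SKA : S @` K `<=` A.
  by move=> _ [_ /KTA[p Ap <-] <-]; rewrite TK.
pose K' : set (plane R) := T' @` (S @` K).
have mK' : measurable K' by exact: measurable_rigid.
have K'E : leb2 R K' = leb2 R K.
  by rewrite leb2_rigid// leb2_rigid//; exists T.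
have K'N : K' `<=` nbhd K r.
  move=> _ [_ [k Kk <-] <-]; exists k => //; rewrite -{1}(SK k).
  by apply: TT'; apply: SKA; exists k.
have mN : measurable (nbhd K r : set (plane R)).
  by apply: measurable_plane; apply: open_measurable2; exact: open_nbhd.
have KK' : (leb2 R (K `\` T' @` A) < (e / 2)%:E)%E.
  apply: (@le_lt_trans _ _ (leb2 R (K `\` K'))).
    by apply: le_outer_measure; apply: setDS; exact: image_subset.
  (* Equal measures allow replacing K minus K' by K' minus K, which lies in the thin shell around
     [K]. *)
  rewrite measure_setD_sym//; last exact: leb2_lty KM.
  by apply: le_lt_trans re; apply: le_outer_measure; exact: setSD.
have TT'e : (leb2 R (T @` A `\` T' @` A) < e%:E)%E.
  exact: (@measure_setD_lt _ _ _ (leb2 R) (T @` A) K (T' @` A) e).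
split => //; rewrite measure_setD_sym//.
  by rewrite leb2_rigid// -(leb2_rigid A rT); exact: leb2_lty TAM.
by rewrite !leb2_rigid.
Qed.

Lemma avg_Rintegral (f : plane R -> R) A :
  (leb2 R).-integrable setT (EFin \o f) -> measurable A ->
  avg f A = (\int[leb2 R]_(x in A) f x / fine (leb2 R A))%:E.
Proof.
move=> intf mA; rewrite /avg /Rintegral EFinM fineK//.
by apply: integrable_fin_num => //; exact: integrableS intf.
Qed.

(** The denominator stays the measure of [A], so only the integral varies. *)
Lemma avg_rigid_gt (f : plane R -> R) T A M (t : R) :
  (leb2 R).-integrable setT (EFin \o f) -> rigid T -> measurable A ->
  T @` A `<=` box M -> (t%:E < avg f (T @` A))%E ->
  exists2 r : R, 0 < r & forall T', rigid T' ->
    (forall p, A p -> ball (T p : R * R) r (T' p)) ->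
    (t%:E < avg f (T' @` A))%E.
Proof.
move=> intf rT mA TAM; have mTA := measurable_rigid rT mA.
rewrite avg_Rintegral// leb2_rigid// lte_fin => tavg.
set I := Rintegral _ _ _ in tavg; set a := fine _ in tavg.
have a0 : 0 <= a^-1 by rewrite invr_ge0 fine_ge0.
have a1 : 0 < a^-1 + 1 by rewrite ltr_wpDl.
(* With this [e], changing the integral by less than [e] leaves an average of at least t + e. The
   summand 1 keeps the divisor positive. *)
pose e := (I / a - t) / (a^-1 + 1).
have e0 : 0 < e by rewrite divr_gt0// subr_gt0.
have [d d0 hd] := Rintegral_continuous intf e0.
have [r r0 hr] := leb2_rigid_continuous rT mA TAM d0.
exists r => // T' rT' TT'; have [TT'd T'Td] := hr _ rT' TT'.
have mT'A := measurable_rigid rT' mA.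
rewrite avg_Rintegral// leb2_rigid// lte_fin -/a.
have := hd _ _ mTA mT'A TT'd T'Td; rewrite -/I.
set J := Rintegral _ _ _ => /(le_lt_trans (ler_norm _)) IJ.
have eE : e * a^-1 + e = I / a - t
  by rewrite -[X in _ + X]mulr1 -mulrDr /e divfK// lt0r_neq0.
have : (I - J) * a^-1 <= e * a^-1 by apply: ler_wpM2r => //; exact: ltW.
by rewrite mulrBl; lra.
Qed.

End rigid_motions.

(** * Rotations and large averages *)

Section rotations.
Variable R : realType.
Implicit Types (g : Gamma2 R) (x p q : borel2 R).

Definition rmotion x g : borel2 R -> borel2 R :=
  motion x.1 x.2 (sval g).1 (sval g).2.

Lemma rigid_rmotion x g : rigid (rmotion x g).
Proof.
case: g => -[c s] /= cs; rewrite /rmotion /=; case: x => a b /=.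
(* The inverse rotates p - x by the opposite angle. *)
exists (motion (- (c * a + s * b)) (s * a - c * b) c (- s)); split.
- exact: preserves_leb_motion.
- by apply: preserves_leb_motion; rewrite sqrrN.
- move=> [u v]; rewrite /motion /=; congr pair.
    by transitivity (u * (c ^+ 2 + s ^+ 2)); [ring | rewrite cs mulr1].
  by transitivity (v * (c ^+ 2 + s ^+ 2)); [ring | rewrite cs mulr1].
- move=> [u v]; rewrite /motion /=; congr pair.
    transitivity (a + (c ^+ 2 + s ^+ 2) * (u - a)); first ring.
    by rewrite cs; ring.
  transitivity (b + (c ^+ 2 + s ^+ 2) * (v - b)); first ring.
  by rewrite cs; ring.
Qed.

Lemma edist_rmotion x g p q :
  Defs.edist (rmotion x g p) (rmotion x g q) = Defs.edist p q.
Proof.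
case: g p q x => -[c s] /= cs [p1 p2] [q1 q2] [a b].
rewrite /Defs.edist /rmotion /motion /=; congr Num.sqrt.
transitivity ((c ^+ 2 + s ^+ 2) * ((p1 - q1) ^+ 2 + (p2 - q2) ^+ 2)).
  by ring.
by rewrite cs mul1r.
Qed.

Lemma diam_rmotion x g (A : set (plane R)) : diam (rmotion x g @` A) = diam A.
Proof.
rewrite /diam; congr ereal_sup; apply/seteqP.
split => [y [[y1 y2] /=]|y [[p q] /=]].
  move=> [[p Ap <-] [q Aq <-]] <-; exists (p, q) => //=.
  by rewrite edist_rmotion.
move=> [Ap Aq] <-; exists (rmotion x g p, rmotion x g q) => /=.
  by split; [exists p|exists q].
by rewrite edist_rmotion.
Qed.

(** Members of [B x] are translates x + A with A in [B (origin R)], so (x, g) enters only through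
    the motion applied to A. *)
Lemma rotated_basisE (B : plane R -> set (set (plane R))) g x :
  translation_invariant B ->
  rotated_basis B g x = [set rmotion x g @` A | A in B (origin R)].
Proof.
move=> Btr; rewrite /rotated_basis Btr.
have E A : [set padd x (Defs.rot g (psub r x)) | r in Defs.shift x A] =
    rmotion x g @` A.
  rewrite /Defs.shift image_comp; congr image; apply/funext => -[u v] /=.
  rewrite /rmotion /motion /padd /Defs.rot /psub /=; case: x => a b /=.
  by rewrite (addrC a u) (addrC b v) !addrK.
apply/seteqP; split => [_ [_ [A BA <-] <-]|_ [A BA <-]].
  by exists A => //; rewrite E.
by exists (Defs.shift x A); [exists A|rewrite E].
Qed.

Lemma Gamma2_le1 g : `|(sval g).1| <= 1 /\ `|(sval g).2| <= 1.
Proof.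
by case: g => -[c s] /= cs; split; rewrite ler_norml; apply/andP; split; nra.
Qed.

Lemma arc_dist_self g : arc_dist g g = 0.
Proof. by case: g => -[c s] /= cs; rewrite /arc_dist /= -!expr2 cs acos1. Qed.

(** The squared chord is 2 - 2 cos of the arc, so continuity of cosine at 0 makes the chord
    short. *)
Lemma arc_dist_lt (e : R) : 0 < e -> exists2 r : R, 0 < r &
  forall g h, arc_dist g h < r ->
    `|(sval g).1 - (sval h).1| < e /\ `|(sval g).2 - (sval h).2| < e.
Proof.
move=> e0; have e2 : 0 < e ^+ 2 / 2 by rewrite divr_gt0// exprn_gt0.
have /cvgrPdist_lt/(_ _ e2)[r /= r0 hr] := @continuous_cos R 0.
exists r => // -[[c s] /= cs] [[c' s'] /= cs']; rewrite /arc_dist /=.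
set u := c * c' + s * s' => ur.
(* Cosine inverts [acos] only on this interval; the bounds come from the squared lengths of g + h
   and g - h. *)
have u1 : -1 <= u <= 1.
  have := sqr_ge0 (c + c'); have := sqr_ge0 (s + s').
  have := sqr_ge0 (c - c'); have := sqr_ge0 (s - s').
  by move=> ? ? ? ?; apply/andP; split; rewrite /u; lra.
have : `|cos 0 - cos (acos u)| < e ^+ 2 / 2.
  apply: hr => /=; rewrite sub0r normrN ger0_norm//; exact: acos_ge0.
rewrite cos0 acosK ?in_itv//= => /(le_lt_trans (ler_norm _)) ue.
have sq : (c - c') ^+ 2 + (s - s') ^+ 2 < e ^+ 2.
  rewrite (_ : _ + _ = (c ^+ 2 + s ^+ 2) + (c' ^+ 2 + s' ^+ 2) - 2 * u).
    by rewrite cs cs'; lra.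
  by rewrite /u; ring.
have e0' := ltW e0.
split; rewrite -(ltr_pXn2r (n := 2))// ?nnegrE// real_normK ?num_real//.
  by apply: le_lt_trans sq; rewrite lerDl sqr_ge0.
by apply: le_lt_trans sq; rewrite lerDr sqr_ge0.
Qed.

Lemma rmotion_near M (r : R) : 0 < r -> exists2 d : R, 0 < d &
  forall x x' g g', ball (x : R * R) d x' -> arc_dist g g' < d ->
  forall p, box M p -> ball (rmotion x g p : R * R) r (rmotion x' g' p).
Proof.
move=> r0; pose m := `|M| + 1; have m0 : 0 < m by rewrite ltr_wpDl.
(* Each of the two rotation terms in a coordinate costs at most r/4, leaving r/2 for the
   translation. *)
pose e := r / (4 * m); have e0 : 0 < e by rewrite divr_gt0// mulr_gt0.
have em : e * m = r / 4 by rewrite /e; field; rewrite gt_eqF.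
have [d d0 hd] := arc_dist_lt e0.
exists (Num.min d (r / 2)); first by rewrite lt_min d0 divr_gt0.
move=> [a b] [a' b'] g g' [/= xa xb]; rewrite lt_min => /andP[/hd[gc gs] _].
have {}xa : `|a - a'| < r / 2.
  by move: xa; rewrite -ball_normE /ball_ /= lt_min => /andP[].
have {}xb : `|b - b'| < r / 2.
  by move: xb; rewrite -ball_normE /ball_ /= lt_min => /andP[].
move=> [p1 p2] [/=]; rewrite !in_itv /= -!ler_norml => p1M p2M.
have Mm : M <= m by rewrite (le_trans (ler_norm _))// lerDl.
have p1m := le_trans p1M Mm; have p2m := le_trans p2M Mm.
have prod_le (y z : R) : `|y| < e -> `|z| <= m -> `|y * z| <= r / 4.
  by move=> ye zm; rewrite normrM -em ler_pM// ltW.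
have tri (y1 y2 y3 : R) : `|y1| < r / 2 -> `|y2| <= r / 4 -> `|y3| <= r / 4 ->
    `|y1 + y2 + y3| < r.
  move=> ? ? ?; apply: (le_lt_trans (ler_normD _ _)).
  by have := ler_normD y1 y2; lra.
rewrite /rmotion /motion; split => /=; rewrite -ball_normE /ball_ /=.
  rewrite [X in `|X|](_ : _ = (a - a') + ((sval g).1 - (sval g').1) * p1
    + ((sval g).2 - (sval g').2) * - p2); last ring.
  by apply: tri => //; apply: prod_le; rewrite ?normrN.
rewrite [X in `|X|](_ : _ = (b - b') + ((sval g).1 - (sval g').1) * p2
  + ((sval g).2 - (sval g').2) * p1); last ring.
by apply: tri => //; apply: prod_le.
Qed.

Lemma bounded2_box (A : set (plane R)) p :
  bounded2 A -> A p -> exists M, A `<=` box M.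
Proof.
case: p => p1 p2 [M AM] Ap; exists (`|p1| + `|p2| + M) => -[q1 q2] Aq.
have := AM _ _ Ap Aq; rewrite /Defs.edist /= => sM.
have M0 : 0 <= M by apply: le_trans sM; exact: sqrtr_ge0.
have [d1 d2] : `|p1 - q1| <= M /\ `|p2 - q2| <= M.
  by split; apply: le_trans sM;
    rewrite -sqrtr_sqr ler_wsqrtr// ?lerDl ?lerDr sqr_ge0.
have := ler_norm p1; have := ler_norm (- p1); rewrite normrN => ? ?.
have := ler_norm p2; have := ler_norm (- p2); rewrite normrN => ? ?.
move: d1 d2; rewrite !ler_norml => /andP[? ?] /andP[? ?].
by split; rewrite /= in_itv /=; apply/andP; split; lra.
Qed.

Lemma rmotion_box x g M : exists M', rmotion x g @` box M `<=` box M'.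
Proof.
case: x => a b; exists (`|a| + `|b| + (`|M| + `|M|)) => _ [[p1 p2] [/=] + + <-].
have [c1 s1] := Gamma2_le1 g; have MM := ler_norm M.
rewrite !in_itv /= -!ler_norml => p1M p2M.
have pr (y z : R) : `|y| <= 1 -> `|z| <= M -> `|y * z| <= `|M|.
  by move=> y1 zM; rewrite normrM -[leRHS]mul1r ler_pM// (le_trans zM).
rewrite /rmotion /motion; split => /=; rewrite in_itv/= -ler_norml.
  apply: (le_trans (ler_normD _ _)); apply: lerD; first by rewrite lerDl.
  by apply: (le_trans (ler_normB _ _)); apply: lerD; exact: pr.
apply: (le_trans (ler_normD _ _)); apply: lerD; first by rewrite lerDr.
by apply: (le_trans (ler_normD _ _)); apply: lerD; exact: pr.
Qed.

End rotations.

(** * Sets of large averages and their measure *)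

Section large_averages.
Variables (R : realType) (B : plane R -> set (set (plane R))).
Variable f : plane R -> R.

(** The sets W_m(g) of the overview. One index controls both diameter and average, so the sets
    decrease in [m]. *)
Definition large_avg (m : nat) (g : Gamma2 R) : set (R * R) :=
  [set x | exists A, [/\ rotated_basis B g x A,
    (diam A < (m.+1%:R^-1)%:E)%E & (m%:R%:E < avg f A)%E]].

Lemma large_avg_le m n g : (m <= n)%N -> large_avg n g `<=` large_avg m g.
Proof.
move=> mn x [A [BA dA fA]]; exists A; split => //.
  by apply: lt_le_trans dA _; rewrite lee_fin inv_nat_le.
by apply: le_lt_trans fA; rewrite lee_fin ler_nat.
Qed.

Lemma upper_der_large_avg g x : upper_der (rotated_basis B g) f x = +oo%E <->
  forall m, large_avg m g x.
Proof.
split=> [xoo m|xl].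
  have m0 : (0 : R) < m.+1%:R^-1 by rewrite invr_gt0.
  pose S := [set avg f A | A in [set A | rotated_basis B g x A /\
    (diam A < (m.+1%:R^-1)%:E)%E]].
  have : (m%:R%:E < ereal_sup S)%E.
    rewrite (@lt_le_trans _ _ +oo%E) ?ltry//.
    by rewrite -xoo; apply: ereal_inf_lbound; exists m.+1%:R^-1.
  by move=> /ereal_sup_gt[_ [A [BA dA] <-] fA]; exists A.
apply/eqP; rewrite -leye_eq; apply: le_ereal_inf_tmp => _ [d /= d0 <-].
rewrite leye_eq; apply/eqP/eq_infty => r.
have [n nd] := inv_nat_lt d0.
have rt : r < (Num.truncn r).+1%:R by exact: truncnS_gt.
(* Large enough for both demands: diameter below [d], average above [r]. *)
pose m := maxn n (Num.truncn r).+1.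
have [A [BA dA fA]] := xl m.
apply: (@le_trans _ _ (avg f A)).
  apply: (le_trans _ (ltW fA)); rewrite lee_fin (le_trans (ltW rt))// ler_nat.
  exact: leq_maxr.
apply: ereal_sup_ubound; exists A => //; split => //.
apply: (lt_trans dA); rewrite lte_fin; apply: le_lt_trans nd.
by apply: inv_nat_le; exact: leq_maxl.
Qed.

Hypotheses (Bdiff : diff_basis B) (Btr : translation_invariant B).
Hypothesis intf : (leb2 R).-integrable setT (EFin \o f).

(** The set [A] at the origin is kept and only the motion varies: the diameter is unchanged and the
    average stays above m. *)
Lemma large_avg_jointly_open m g x : large_avg m g x ->
  exists2 d : R, 0 < d & forall x' g',
    ball x d x' -> arc_dist g g' < d -> large_avg m g' x'.
Proof.
move=> [A' []]; rewrite rotated_basisE// => -[A BA <-] dA fA.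
have [/(_ _ BA)[mA bA _ A0] _] := Bdiff (origin R).
have [M AM] := bounded2_box bA A0.
have [M' TM'] := rmotion_box x g M.
have TAM' : rmotion x g @` A `<=` box M'.
  by apply: subset_trans TM'; exact: image_subset.
have [r r0 hr] := avg_rigid_gt intf (rigid_rmotion x g) mA TAM' fA.
have [d d0 hd] := rmotion_near M r0.
exists d => // x' g' xx' gg'; exists (rmotion x' g' @` A); split.
- by rewrite rotated_basisE//; exists A.
- by move: dA; rewrite !diam_rmotion.
- by apply: hr => [|p /AM]; [exact: rigid_rmotion|exact: hd].
Qed.

Lemma open_large_avg m g : open (large_avg m g).
Proof.
rewrite openE => x /large_avg_jointly_open[d d0 hd].
apply/nbhs_ballP; exists d => //= x' xx'; apply: hd => //.
by rewrite arc_dist_self.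
Qed.

(** [V k] collects the points with a ball inside W_m(g') for all g' within 1/(k+1) of g. These sets
    are open, increase with k and by joint openness exhaust W_m(g). So the part in the box of some
    [V k] has measure above [r], and that [V k] lies in W_m(h) for every h that close to g. *)
Lemma large_avg_measure_open m (r : R) :
  Gamma2_open [set g | (r%:E < leb2 R (box 1 `&` large_avg m g))%E].
Proof.
move=> g /= rg.
pose V (k : nat) : set (R * R) := [set x | exists2 e : R, 0 < e &
  forall x', ball x e x' -> forall g', arc_dist g g' < k.+1%:R^-1 ->
    large_avg m g' x'].
have oV k : open (V k).
  rewrite openE => x [e e0 he]; apply/nbhs_ballP.
  exists (e / 2) => /=; first by rewrite divr_gt0.
  move=> y xy; exists (e / 2); first by rewrite divr_gt0.
  by move=> z yz; apply: he; rewrite [e]splitr; exact: ball_triangle yz.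
have mV k : measurable (box 1 `&` V k : set (plane R)).
  apply: measurable_plane; apply: measurableI; first exact: measurable_box.
  exact: open_measurable2.
have [|||k hk] := @measure_bigcup_gt _ _ _ (leb2 R)
    (fun k => box 1 `&` V k) r%:E.
- exact: mV.
- move=> n k nk; apply/subsetPset; apply: setIS => x [e e0 he]; exists e => //.
  move=> x' xx' g' gg'; apply: he => //; apply: lt_le_trans gg' _.
  exact: inv_nat_le.
- apply: (lt_le_trans rg); apply: le_outer_measure => x [bx].
  move=> /large_avg_jointly_open[d d0 hd]; have [k kd] := inv_nat_lt d0.
  exists k => //; split => //; exists d => // x' xx' g' gg'.
  by apply: hd => //; exact: lt_trans kd.
exists k.+1%:R^-1; first by rewrite invr_gt0.
move=> h gh /=; apply: (lt_le_trans hk); apply: le_outer_measure.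
by apply: setIS => x [e e0 he]; apply: he => //; exact: ballxx.
Qed.

(** The square has measure 4; any threshold strictly between 0 and 4 would separate the two cases
    below. *)
Lemma leb2_box1_gt1 : (1%:E < leb2 R (box 1))%E.
Proof.
rewrite leb2_borel; last exact: measurable_box.
rewrite /leb_prod product_measure1E//= lebesgue_measure_itv/=.
rewrite lte_fin ifT; last by lra.
by rewrite -EFinB -EFinM lte_fin; lra.
Qed.

Lemma large_avg_full g :
  {ae leb2 R, forall x, upper_der (rotated_basis B g) f x = +oo%E} ->
  forall m, (1%:E < leb2 R (box 1 `&` large_avg m g))%E.
Proof.
move=> [N [mN N0 hN]] m; apply: (lt_le_trans leb2_box1_gt1).
rewrite -[leRHS]adde0 -[in leRHS]N0.
apply: (@le_trans _ _ (leb2 R ((box 1 `&` large_avg m g) `|` N))).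
  apply: le_outer_measure => x bx.
  have [Nx|nNx] := pselect (N x); first by right.
  left; split => //; move: m; apply/upper_der_large_avg.
  by apply: contrapT => nx; apply: nNx; exact: hN.
exact: outer_measureU2.
Qed.

Lemma large_avg_small g : differentiates (rotated_basis B g) f ->
  exists m, (leb2 R (box 1 `&` large_avg m g) < 1%:E)%E.
Proof.
move=> [N [mN N0 hN]].
have mW m : measurable (box 1 `&` large_avg m g : set (plane R)).
  apply: measurable_plane; apply: measurableI; first exact: measurable_box.
  by apply: open_measurable2; exact: open_large_avg.
apply: (@measure_bigcap_lt _ _ _ (leb2 R)) => //.
- by apply: (@leb2_lty _ _ 1) => x [].
- by move=> n k nk; apply/subsetPset; apply: setIS; exact: large_avg_le.
apply: (@le_lt_trans _ _ (leb2 R N)); last by rewrite N0 lte_fin.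
(* In all the sets the upper derivative is infinite, whereas [f x] is a real number, so [x] lies in
   the null set [N]. *)
apply: le_outer_measure => x Wx; apply: hN => -[+ _].
have /upper_der_large_avg -> // : forall m, large_avg m g x.
by move=> m; have [] := Wx m Logic.I.
Qed.

End large_averages.

Theorem theorem1 (R : realType) (B : plane R -> set (set (plane R))) :
  diff_basis B -> translation_invariant B ->
  forall E : set (Gamma2 R), RB_set B E -> Gdelta E.
Proof.
move=> Bdiff Btr E [f [intf [fE fnE]]].
exists (fun m => [set g | (1%:E < leb2 R (box 1 `&` large_avg B f m g))%E]).
split; first by move=> m; exact: large_avg_measure_open.
apply/seteqP; split => [g Eg m _|g Wg]; first exact: large_avg_full (fE g Eg) m.
apply: contrapT => /fnE /(large_avg_small Bdiff Btr intf)[m].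
by move/lt_trans/(_ (Wg m Logic.I)); rewrite ltxx.
Qed.
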